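(* Let $(D,\dashv,\vdash)$ be a diassociative algebra, $(B,\diamond,\varpi)$ a quadratic Zinbiel algebra, and $(D\otimes B,\cdot)$ the induced associative algebra, with $(d_1\otimes b_1)\cdot(d_2\otimes b_2)=(d_1\vdash d_2)\otimes(b_1\diamond b_2)+(d_1\dashv d_2)\otimes(b_2\diamond b_1)$. Suppose $r=\sum_ix_i\otimes y_i\in D\otimes D$ is a symmetric solution of the diassociative Yang-Baxter equation in $(D,\dashv,\vdash)$. Then $$\widetilde r=\sum_{i,j}(x_i\otimes e_j)\otimes(y_i\otimes f_j)\in(D\otimes B)\otimes(D\otimes B)$$ is a skew-symmetric solution of the associative Yang-Baxter equation in $(D\otimes B,\cdot)$, where $\{e_1,\dots,e_n\}$ is a basis of $B$ and $\{f_1,\dots,f_n\}$ is its dual basis with respect to $\varpi$, i.e. $\varpi(f_i,e_j)=\delta_{ij}$.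
   Context: All vector spaces are finite-dimensional over a field $\Bbbk$ of characteristic zero; $\tau(x\otimes y)=y\otimes x$; an element $s$ is symmetric if $\tau(s)=s$, skew-symmetric if $\tau(s)=-s$. A diassociative algebra $(D,\dashv,\vdash)$ is a vector space with two associative products satisfying $(d_1\dashv d_2)\dashv d_3=d_1\dashv(d_2\vdash d_3)$, $(d_1\vdash d_2)\dashv d_3=d_1\vdash(d_2\dashv d_3)$, $(d_1\dashv d_2)\vdash d_3=(d_1\vdash d_2)\vdash d_3$. The diassociative Yang-Baxter equation (DAYBE) for $r=\sum_ix_i\otimes y_i$ is $\sum_{i,j}\big(x_i\otimes x_j\otimes(y_i\vdash y_j)-x_j\otimes(x_i\dashv y_j)\otimes y_i-(x_i\vdash x_j)\otimes y_i\otimes y_j+(x_i\dashv x_j)\otimes y_i\otimes y_j\big)=0$. A Zinbiel algebra satisfies $b_1\diamond(b_2\diamond b_3)=(b_1\diamond b_2)\diamond b_3+(b_2\diamond b_1)\diamond b_3$; it is quadratic if equipped with a nondegenerate skew-symmetric bilinear form with $\varpi(b_1\diamond b_2,b_3)=\varpi(b_2,b_1\diamond b_3+b_3\diamond b_1)$. The associative Yang-Baxter equation (AYBE) in $(A,\cdot)$ for $s=\sum_iu_i\otimes v_i$ is $\sum_{i,j}\big((u_i\cdot u_j)\otimes v_i\otimes v_j+u_i\otimes u_j\otimes(v_i\cdot v_j)-u_j\otimes(u_i\cdot v_j)\otimes v_i\big)=0$. *)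

(* Defs.v *)
From HB Require Import structures.
From mathcomp Require Import all_boot all_order all_algebra.

Set Implicit Arguments.
Unset Strict Implicit.
Unset Printing Implicit Defensive.

Import GRing.Theory.
Import VectorInternalTheory.

Local Open Scope ring_scope.

Reserved Notation "u ⊗ v" (at level 40, left associativity).
Reserved Notation "a ⊣ b" (at level 39, left associativity).
Reserved Notation "a ⊢ b" (at level 39, left associativity).
Reserved Notation "a ⋄ b" (at level 39, left associativity).
Reserved Notation "a ∙ b" (at level 39, left associativity).

(* The tensor product of two finite-dimensional vector spaces, realised as the
   space of coordinate matrices on the bases underlying U and V. The lemmas
   tensor_extE, eq_tensor and tensor_sumP are its universal property. *)
Definition tensor (K : fieldType) (U V : vectType K) : Type :=
  'M[K]_(dim U, dim V).

HB.instance Definition _ (K : fieldType) (U V : vectType K) :=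
  Vector.copy (tensor U V) 'M[K]_(dim U, dim V).

HB.lock Definition tens (K : fieldType) (U V : vectType K) (u : U) (v : V)
  : tensor U V := (v2r u)^T *m v2r v.

(* The linear map on U ⊗ V sending u ⊗ v to f u v, for f bilinear. *)
HB.lock Definition tensor_ext (K : fieldType) (U V W : vectType K)
    (f : U -> V -> W) (t : tensor U V) : W :=
  \sum_i \sum_j t i j *: f (r2v (delta_mx 0 i)) (r2v (delta_mx 0 j)).

Notation "u ⊗ v" := (tens u v) : ring_scope.

Section TensorTheory.
Variable K : fieldType.
Implicit Types U V W : vectType K.

Lemma tens_mx U V (u : U) (v : V) : u ⊗ v = (v2r u)^T *m v2r v.
Proof. by rewrite unlock. Qed.

Lemma tensor_ext_sum U V W (f : U -> V -> W) t :
  tensor_ext f t =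
  \sum_i \sum_j t i j *: f (r2v (delta_mx 0 i)) (r2v (delta_mx 0 j)).
Proof. by rewrite unlock. Qed.

Definition bilin U V W (f : U -> V -> W) : Prop :=
  (forall v, linear (f^~ v)) /\ (forall u, linear (f u)).

Lemma tens_bilin U V : bilin (@tens K U V).
Proof.
by split=> [v|u] a x y; rewrite !tens_mx linearP /= ?linearP /=
   ?mulmxDl ?mulmxDr ?scalemxAl ?scalemxAr.
Qed.

HB.instance Definition _ U V :=
  bilinear_isBilinear.Build K U V (tensor U V)
    (GRing.Scale.Law.clone _ _ *:%R _) (GRing.Scale.Law.clone _ _ *:%R _)
    (@tens K U V) (tens_bilin U V).

Lemma tensor_ext_linear U V W (f : U -> V -> W) : linear (tensor_ext f).
Proof.
move=> a s t; rewrite !tensor_ext_sum scaler_sumr -big_split /=.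
apply: eq_bigr => i _; rewrite scaler_sumr -big_split /=.
by apply: eq_bigr => j _; rewrite !mxE scalerDl scalerA.
Qed.

HB.instance Definition _ U V W (f : U -> V -> W) :=
  GRing.isLinear.Build K (tensor U V) W *:%R (tensor_ext f)
    (tensor_ext_linear f).

Lemma v2r_sum U (u : U) : u = \sum_i v2r u 0 i *: r2v (delta_mx 0 i).
Proof.
rewrite -[LHS]v2rK {1}[v2r u]row_sum_delta linear_sum /=.
by apply: eq_bigr => i _; rewrite linearZ.
Qed.

Lemma lin_sumZ U W (f : U -> W) (I : finType) (c : I -> K) (u : I -> U) :
  linear f -> f (\sum_i c i *: u i) = \sum_i c i *: f (u i).
Proof.
move=> lf; pose F : {linear U -> W} :=
  HB.pack f (GRing.isLinear.Build K U W *:%R f lf).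
rewrite -[f]/(F : U -> W) linear_sum; apply: eq_bigr => i _; exact: linearZ.
Qed.

Lemma tensor_extE U V W (f : U -> V -> W) u v :
  bilin f -> tensor_ext f (u ⊗ v) = f u v.
Proof.
case=> fl fr; rewrite [in RHS](v2r_sum u) (lin_sumZ _ _ (fl v)) tensor_ext_sum.
apply: eq_bigr => i _; rewrite [in RHS](v2r_sum v) (lin_sumZ _ _ (fr _)).
rewrite scaler_sumr; apply: eq_bigr => j _; rewrite scalerA; congr (_ *: _).
by rewrite tens_mx !mxE big_ord1 !mxE.
Qed.

Lemma tensor_sumP U V (t : tensor U V) :
  exists (I : finType) (x : I -> U) (y : I -> V), t = \sum_i x i ⊗ y i.
Proof.
pose x (p : 'I_(dim U) * 'I_(dim V)) : U := t p.1 p.2 *: r2v (delta_mx 0 p.1).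
pose y (p : 'I_(dim U) * 'I_(dim V)) : V := r2v (delta_mx 0 p.2).
exists ('I_(dim U) * 'I_(dim V))%type, x, y.
rewrite -(pair_bigA _ (fun i j => x (i, j) ⊗ y (i, j))) /= {1}[t]matrix_sum_delta.
apply: eq_bigr => i _; apply: eq_bigr => j _.
by rewrite /x /y /= linearZl_LR /= tens_mx !r2vK trmx_delta mul_delta_mx.
Qed.

Lemma eq_tensor U V W (g h : {linear tensor U V -> W}) :
  (forall u v, g (u ⊗ v) = h (u ⊗ v)) -> g =1 h.
Proof.
move=> gh t; have [I [x [y ->]]] := tensor_sumP t.
by rewrite !linear_sum; apply: eq_bigr.
Qed.

Definition tswap U V : tensor U V -> tensor V U :=
  tensor_ext (fun u v => v ⊗ u).

Lemma tswapE U V (u : U) (v : V) : tswap (u ⊗ v) = v ⊗ u.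
Proof.
rewrite /tswap tensor_extE //.
by split=> w; [apply: (tens_bilin V U).2 | apply: (tens_bilin V U).1].
Qed.

Definition tsymmetric U (s : tensor U U) : Prop := tswap s = s.
Definition tskew U (s : tensor U U) : Prop := tswap s = - s.

End TensorTheory.

HB.mixin Record Vector_isDiassociative (K : fieldType) D of Vector K D := {
  dashv : D -> D -> D;
  vdash : D -> D -> D;
  dashv_bilin : bilin dashv;
  vdash_bilin : bilin vdash;
  dashvA : associative dashv;
  vdashA : associative vdash;
  dashv_vdash : forall a b c : D, dashv (dashv a b) c = dashv a (vdash b c);
  vdash_dashv : forall a b c : D, dashv (vdash a b) c = vdash a (dashv b c);
  dashv_vdashl : forall a b c : D, vdash (dashv a b) c = vdash (vdash a b) c
}.

#[short(type="diassAlgType")]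
HB.structure Definition DiassAlgebra (K : fieldType) :=
  { D of Vector K D & Vector_isDiassociative K D }.

Notation "a ⊣ b" := (dashv a b) : ring_scope.
Notation "a ⊢ b" := (vdash a b) : ring_scope.

HB.mixin Record Vector_isZinbiel (K : fieldType) B of Vector K B := {
  zmul : B -> B -> B;
  zmul_bilin : bilin zmul;
  zmulP : forall a b c : B, zmul a (zmul b c) = zmul (zmul a b) c + zmul (zmul b a) c
}.

#[short(type="zinbielAlgType")]
HB.structure Definition ZinbielAlgebra (K : fieldType) :=
  { B of Vector K B & Vector_isZinbiel K B }.

Notation "a ⋄ b" := (zmul a b) : ring_scope.

Definition quadratic_zinbiel (K : fieldType) (B : zinbielAlgType K)
    (w : {skew_symmetric B}) : Prop :=
  nondegenerate w /\
  forall b1 b2 b3 : B, w (b1 ⋄ b2) b3 = w b2 (b1 ⋄ b3 + b3 ⋄ b1).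

(* Associative algebras without unit. *)
HB.mixin Record Vector_isAssociative (K : fieldType) A of Vector K A := {
  amul : A -> A -> A;
  amul_bilin : bilin amul;
  amulA : associative amul
}.

#[short(type="assocAlgType")]
HB.structure Definition AssocAlgebra (K : fieldType) :=
  { A of Vector K A & Vector_isAssociative K A }.

Notation "a ∙ b" := (amul a b) : ring_scope.

Section BilinTheory.
Variables (K : fieldType) (U V W : vectType K) (f : U -> V -> W).
Hypothesis bf : bilin f.

Lemma bilinPl v a x y : f (a *: x + y) v = a *: f x v + f y v.
Proof. by case: bf => fl fr; rewrite ?fl ?fr. Qed.

Lemma bilinPr u a x y : f u (a *: x + y) = a *: f u x + f u y.
Proof. by case: bf => fl fr; rewrite ?fl ?fr. Qed.

Lemma bilinDl v x y : f (x + y) v = f x v + f y v.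
Proof. by rewrite -[x in LHS]scale1r bilinPl scale1r. Qed.

Lemma bilinDr u x y : f u (x + y) = f u x + f u y.
Proof. by rewrite -[x in LHS]scale1r bilinPr scale1r. Qed.

Lemma bilin0l v : f 0 v = 0.
Proof. by apply: (addrI (f 0 v)); rewrite -bilinDl !addr0. Qed.

Lemma bilin0r u : f u 0 = 0.
Proof. by apply: (addrI (f u 0)); rewrite -bilinDr !addr0. Qed.

Lemma bilin_suml (I : finType) (F : I -> U) v :
  f (\sum_i F i) v = \sum_i f (F i) v.
Proof. exact: (big_morph (f^~ v) (bilinDl v) (bilin0l v)). Qed.

Lemma bilin_sumr (I : finType) (F : I -> V) u :
  f u (\sum_i F i) = \sum_i f u (F i).
Proof. exact: (big_morph (f u) (bilinDr u) (bilin0r u)). Qed.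

End BilinTheory.

Lemma linear_comb3 (K : fieldType) (V W : vectType K) (f g h : V -> W) :
  linear f -> linear g -> linear h -> linear (fun x => f x + g x - h x).
Proof.
move=> lf lg lh a x y; rewrite lf lg lh !scalerDr !opprD scalerN.
by rewrite (addrACA (a *: f x)) (addrACA (a *: f x + _)).
Qed.

Lemma linear_comb4 (K : fieldType) (V W : vectType K) (f g h k : V -> W) :
  linear f -> linear g -> linear h -> linear k ->
  linear (fun x => f x - g x - h x + k x).
Proof.
move=> lf lg lh lk a x y; rewrite lf lg lh lk !scalerDr !opprD !scalerN.
by rewrite (addrACA (a *: f x)) (addrACA (a *: f x + _)) (addrACA (a *: f x + _ + _)).
Qed.

(* For F linear in each argument, tensor_ext2 F r r is the value of
   sum_(i, j) F x_i y_i x_j y_j at r = sum_i x_i ⊗ y_i; it depends only on the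
   tensor r, not on the chosen decomposition (tensor_ext2_sum). *)
Definition tensor_ext2 (K : fieldType) (U V U' V' W : vectType K)
    (F : U -> V -> U' -> V' -> W) (s : tensor U V) (t : tensor U' V') : W :=
  tensor_ext (fun u v => tensor_ext (F u v) t) s.

Section TensorExt2.
Variables (K : fieldType) (U V U' V' W : vectType K).
Variable F : U -> V -> U' -> V' -> W.
Hypothesis F1 : forall v u' v', linear (fun u => F u v u' v').
Hypothesis F2 : forall u u' v', linear (fun v => F u v u' v').
Hypothesis F34 : forall u v, bilin (F u v).

Lemma tensor_ext_bilin t : bilin (fun u v => tensor_ext (F u v) t).
Proof.
split=> [v|u] a x y; rewrite !tensor_ext_sum scaler_sumr -big_split /=;
  apply: eq_bigr => i _; rewrite scaler_sumr -big_split /=;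
  apply: eq_bigr => j _; rewrite ?F1 ?F2 scalerDr !scalerA [a * _]mulrC //.
Qed.

Lemma tensor_ext2E u v u' v' :
  tensor_ext2 F (u ⊗ v) (u' ⊗ v') = F u v u' v'.
Proof.
rewrite /tensor_ext2 tensor_extE; last exact: tensor_ext_bilin.
by rewrite tensor_extE.
Qed.

Lemma tensor_ext2_bilin : bilin (tensor_ext2 F).
Proof.
split=> [t|s]; first exact: tensor_ext_linear.
move=> a x y; rewrite /tensor_ext2 !tensor_ext_sum [X in _ = X + _]scaler_sumr -big_split /=.
apply: eq_bigr => i _; rewrite [X in _ = X + _]scaler_sumr -big_split /=.
apply: eq_bigr => j _.
have E := tensor_ext_linear (F (r2v (delta_mx 0 i)) (r2v (delta_mx 0 j))) a x y.
by rewrite E scalerDr !scalerA [a * _]mulrC.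
Qed.

Lemma tensor_ext2_sum (I J : finType) (x : I -> U) (y : I -> V)
    (x' : J -> U') (y' : J -> V') :
  tensor_ext2 F (\sum_i x i ⊗ y i) (\sum_j x' j ⊗ y' j) =
  \sum_i \sum_j F (x i) (y i) (x' j) (y' j).
Proof.
rewrite (bilin_suml tensor_ext2_bilin); apply: eq_bigr => i _.
rewrite (bilin_sumr tensor_ext2_bilin); apply: eq_bigr => j _.
exact: tensor_ext2E.
Qed.

End TensorExt2.

Section DAYBE.
Variables (K : fieldType) (D : diassAlgType K).

Definition daybe_term (x y x' y' : D) : tensor (tensor D D) D :=
  x ⊗ x' ⊗ (y ⊢ y') - x' ⊗ (x ⊣ y') ⊗ y
  - (x ⊢ x') ⊗ y ⊗ y' + (x ⊣ x') ⊗ y ⊗ y'.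

Definition daybe (r : tensor D D) : Prop := tensor_ext2 daybe_term r r = 0.

Lemma daybeE (I : finType) (x y : I -> D) :
  daybe (\sum_i x i ⊗ y i) <->
  \sum_i \sum_j
     (x i ⊗ x j ⊗ (y i ⊢ y j) - x j ⊗ (x i ⊣ y j) ⊗ y i
      - (x i ⊢ x j) ⊗ y i ⊗ y j + (x i ⊣ x j) ⊗ y i ⊗ y j) = 0.
Proof.
rewrite /daybe tensor_ext2_sum //; rewrite /daybe_term => *; try split => *;
  apply: linear_comb4 => ? ? ?;
  by rewrite ?(bilinPl (@vdash_bilin _ _), bilinPr (@vdash_bilin _ _),
    bilinPl (@dashv_bilin _ _), bilinPr (@dashv_bilin _ _),
    bilinPl (@tens_bilin _ _ _), bilinPr (@tens_bilin _ _ _)).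
Qed.

End DAYBE.

Section AYBE.
Variables (K : fieldType) (A : assocAlgType K).

Definition aybe_term (u v u' v' : A) : tensor (tensor A A) A :=
  (u ∙ u') ⊗ v ⊗ v' + u ⊗ u' ⊗ (v ∙ v') - u' ⊗ (u ∙ v') ⊗ v.

Definition aybe (s : tensor A A) : Prop := tensor_ext2 aybe_term s s = 0.

Lemma aybeE (I : finType) (u v : I -> A) :
  aybe (\sum_i u i ⊗ v i) <->
  \sum_i \sum_j
     ((u i ∙ u j) ⊗ v i ⊗ v j + u i ⊗ u j ⊗ (v i ∙ v j)
      - u j ⊗ (u i ∙ v j) ⊗ v i) = 0.
Proof.
rewrite /aybe tensor_ext2_sum //; rewrite /aybe_term => *; try split => *;
  apply: linear_comb3 => ? ? ?;
  by rewrite ?(bilinPl (@amul_bilin _ _), bilinPr (@amul_bilin _ _),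
    bilinPl (@tens_bilin _ _ _), bilinPr (@tens_bilin _ _ _)).
Qed.

End AYBE.

Section Induced.
Variables (K : fieldType) (D : diassAlgType K) (B : zinbielAlgType K).

Definition induced_term (d1 : D) (b1 : B) (d2 : D) (b2 : B) : tensor D B :=
  (d1 ⊢ d2) ⊗ (b1 ⋄ b2) + (d1 ⊣ d2) ⊗ (b2 ⋄ b1).

Definition induced_mul : tensor D B -> tensor D B -> tensor D B :=
  tensor_ext2 induced_term.

Let lin2 (V W : vectType K) (f g : V -> W) :
  linear f -> linear g -> linear (fun x => f x + g x).
Proof. by move=> lf lg a x y; rewrite lf lg scalerDr addrACA. Qed.

Let bil := (bilinPl (@vdash_bilin _ D), bilinPr (@vdash_bilin _ D),
    bilinPl (@dashv_bilin _ D), bilinPr (@dashv_bilin _ D),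
    bilinPl (@zmul_bilin _ B), bilinPr (@zmul_bilin _ B),
    bilinPl (tens_bilin D B), bilinPr (tens_bilin D B)).

Let F1 v u' v' : linear (fun u => induced_term u v u' v').
Proof. by apply: lin2 => ? ? ?; rewrite !bil. Qed.
Let F2 u u' v' : linear (fun v => induced_term u v u' v').
Proof. by apply: lin2 => ? ? ?; rewrite !bil. Qed.
Let F34 u v : bilin (induced_term u v).
Proof. by split=> ?; apply: lin2 => ? ? ?; rewrite !bil. Qed.

Lemma induced_mulE (d1 d2 : D) (b1 b2 : B) :
  induced_mul (d1 ⊗ b1) (d2 ⊗ b2) =
  (d1 ⊢ d2) ⊗ (b1 ⋄ b2) + (d1 ⊣ d2) ⊗ (b2 ⋄ b1).
Proof. exact: tensor_ext2E. Qed.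

Lemma induced_mul_bilin : bilin induced_mul.
Proof. exact: tensor_ext2_bilin. Qed.

Let assoc_of_E (m : tensor D B -> tensor D B -> tensor D B) :
  (forall d1 d2 b1 b2, m (d1 ⊗ b1) (d2 ⊗ b2) = induced_term d1 b1 d2 b2) ->
  bilin m -> associative m.
Proof.
rewrite /induced_term => mE bm s t u.
have [I [x [y ->]]] := tensor_sumP s; have [J [x' [y' ->]]] := tensor_sumP t.
have [L [x'' [y'' ->]]] := tensor_sumP u.
have suml (M : finType) (F : M -> tensor D B) v :
  m (\sum_i F i) v = \sum_i m (F i) v := bilin_suml bm F v.
have sumr (M : finType) (F : M -> tensor D B) v :
  m v (\sum_i F i) = \sum_i m v (F i) := bilin_sumr bm F v.
rewrite 4!suml; apply: eq_bigr => i _.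
rewrite sumr [X in _ = m X _]sumr suml; apply: eq_bigr => j _.
rewrite 3!sumr; apply: eq_bigr => k _.
rewrite !mE (bilinDr bm) (bilinDl bm) !mE.
have E (d1 d2 d3 : D) : d1 ⊣ (d2 ⊣ d3) = d1 ⊣ (d2 ⊢ d3).
  by rewrite -dashv_vdash dashvA.
have C (a b c : B) : c ⋄ (a ⋄ b) = a ⋄ (c ⋄ b) by rewrite !zmulP addrC.
rewrite E -[x i ⊣ x' j ⊣ x'' k]dashvA E dashv_vdashl -!vdashA vdash_dashv.
rewrite (C (y i) (y' j)) (zmulP (y i) (y' j)) (zmulP (y'' k) (y' j)).
rewrite !(bilinDr (tens_bilin D B)) -!addrA; congr (_ + _).
rewrite [RHS]addrCA; congr (_ + _).
by rewrite addrCA; congr (_ + _); apply: addrC.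
Qed.

Lemma induced_mulA : associative induced_mul.
Proof. exact: (assoc_of_E induced_mulE induced_mul_bilin). Qed.

Definition induced : Type := tensor D B.
HB.instance Definition _ := Vector.on induced.
HB.instance Definition _ := Vector_isAssociative.Build K induced
  induced_mul_bilin induced_mulA.

Lemma inducedE (d1 d2 : D) (b1 b2 : B) :
  (d1 ⊗ b1 : induced) ∙ (d2 ⊗ b2 : induced) =
  ((d1 ⊢ d2) ⊗ (b1 ⋄ b2) : induced) + ((d1 ⊣ d2) ⊗ (b2 ⋄ b1) : induced).
Proof. exact: induced_mulE. Qed.

End Induced.

(* Main.v *)
(* Contracting a tensor in B ⊗ B ⊗ B with ϖ in each slot turns the six
   products of two copies of Σ e_j ⊗ f_j into values of the trilinear form
   ϖ(a ⋄ b, c). Invariance of ϖ leaves only two independent values among the six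
   permutations of (a, b, c), so the associative Yang-Baxter expression of r~
   splits into two expressions in D ⊗ D ⊗ D. Since r is symmetric, the first is
   the image of the diassociative Yang-Baxter expression of r under a cyclic
   permutation of the factors, and the second is the sum of the first and of
   that expression itself. *)
Require Import Defs.
From HB Require Import structures.
From mathcomp Require Import all_boot all_order all_algebra.

Set Implicit Arguments.
Unset Strict Implicit.
Unset Printing Implicit Defensive.

Import GRing.Theory.

Local Open Scope ring_scope.

(** * Trilinear maps on a threefold tensor product *)

Section Trilinear.
Variables (K : fieldType) (U1 U2 U3 W : vectType K).

Definition trilin (T : U1 -> U2 -> U3 -> W) : Prop :=
  [/\ forall v w, linear (fun u => T u v w),
      forall u w, linear (fun v => T u v w)
    & forall u v, linear (T u v)].

Variable T : U1 -> U2 -> U3 -> W.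
Hypothesis Ttri : trilin T.

Lemma trilinP1 v w a u u' : T (a *: u + u') v w = a *: T u v w + T u' v w.
Proof. by case: Ttri => T1 _ _; rewrite T1. Qed.

Lemma trilinP2 u w a v v' : T u (a *: v + v') w = a *: T u v w + T u v' w.
Proof. by case: Ttri => _ T2 _; rewrite T2. Qed.

Lemma trilinP3 u v a w w' : T u v (a *: w + w') = a *: T u v w + T u v w'.
Proof. by case: Ttri => _ _ T3; rewrite T3. Qed.

Lemma tensor_ext_tens t w :
  tensor_ext (fun s w => tensor_ext (fun u v => T u v w) s) (t ⊗ w)
  = tensor_ext (fun u v => T u v w) t.
Proof.
apply: tensor_extE; split=> [z|s] a b c; first exact: linearP.
rewrite !tensor_ext_sum scaler_sumr -big_split; apply: eq_bigr => i _ /=.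
rewrite scaler_sumr -big_split; apply: eq_bigr => j _ /=.
by rewrite trilinP3 scalerDr !scalerA [a * _]mulrC.
Qed.

(** Nesting [tensor_ext] yields the linear map induced by a trilinear [T], through which [T] can be
    applied to the Yang-Baxter expression of r. *)
Lemma tensor_ext_tens3 u v w :
  tensor_ext (fun s w => tensor_ext (fun u v => T u v w) s) (u ⊗ v ⊗ w)
  = T u v w.
Proof.
rewrite tensor_ext_tens tensor_extE //.
by split=> z a b c; rewrite (trilinP1, trilinP2).
Qed.

End Trilinear.


(** * Dual bases for a skew-symmetric form *)

Section DualBases.
Variables (K : fieldType) (B : vectType K) (w : {skew_symmetric B}).
Variables (n : nat) (e f : n.-tuple B).
Hypothesis ebasis : basis_of {:B} e.
Hypothesis fdual : forall i j, w (tnth f i) (tnth e j) = (i == j)%:R.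

Lemma skewC u v : w u v = - w v u.
Proof. by rewrite hermC /= expr1 mulN1r. Qed.

Lemma dual_basis_expansion b : b = \sum_j w (tnth f j) b *: tnth e j.
Proof.
rewrite [LHS](coord_basis ebasis (memvf b)).
apply: eq_bigr => j _; rewrite -tnth_nth; congr (_ *: _).
rewrite [in RHS](coord_basis ebasis (memvf b)) linear_sumr /= (bigD1 j) //=.
rewrite linearZr_LR /= -tnth_nth fdual eqxx mulr1 big1 ?addr0 // => k kj.
by rewrite linearZr_LR /= -tnth_nth fdual eq_sym (negPf kj) mulr0.
Qed.

(** The difference [d] of the two sides is orthogonal to every e_j, hence to B; by skew-symmetry its
    coordinates w(f_j, d) vanish too. *)
Lemma basis_expansion b : b = \sum_j w b (tnth e j) *: tnth f j.
Proof.
apply/eqP; rewrite -subr_eq0; set d := _ - _.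
have de j : w d (tnth e j) = 0.
  rewrite linearBl linear_sumlz /= (bigD1 j) //= linearZl_LR /= fdual eqxx.
  rewrite mulr1 big1 ?addr0 ?subrr // => k kj.
  by rewrite linearZl_LR /= fdual (negPf kj) mulr0.
have d0 v : w d v = 0.
  rewrite [v]dual_basis_expansion linear_sumr /= big1 // => j _.
  by rewrite linearZr_LR /= de mulr0.
by rewrite [d]dual_basis_expansion big1 // => j _; rewrite skewC d0 oppr0 scale0r.
Qed.

(** Writing each e_j in the f_m gives the coefficients w(e_j, e_m), a skew matrix; the sign comes
    from transposing it. *)
Lemma dual_bases_skew (W : vectType K) (T : B -> B -> W) : bilin T ->
  \sum_j T (tnth e j) (tnth f j) = - \sum_j T (tnth f j) (tnth e j).
Proof.
move=> Tb.
under eq_bigr => j _ do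
  rewrite {1}[tnth e j]basis_expansion (lin_sumZ _ _ (Tb.1 _)).
rewrite exchange_big -sumrN; apply: eq_bigr => m _ /=.
rewrite -(lin_sumZ _ _ (Tb.2 _)) -[- T _ _]scaleN1r.
rewrite [tnth e m in RHS]basis_expansion (lin_sumZ _ _ (Tb.2 _)).
rewrite (lin_sumZ _ _ (Tb.2 _)) scaler_sumr; apply: eq_bigr => j _.
by rewrite scalerA mulN1r -skewC.
Qed.

Section TripleProducts.
Variables (W : vectType K) (T : B -> B -> B -> W) (m : B -> B -> B).
Hypotheses (Ttri : trilin T) (mbil : bilin m).

Let P := (trilinP1 Ttri, trilinP2 Ttri, trilinP3 Ttri,
          bilinPl mbil, bilinPr mbil).

(** A triple [t] = (a, b, c) indexes f_a, f_b, f_c in the three slots. Here b and c are the given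
    indices, and a arises from expanding the product. The product [m] is arbitrary so as to cover
    both ⋄ and its opposite. *)
Lemma dual_bases_prod1 :
  \sum_j \sum_l T (m (tnth e j) (tnth e l)) (tnth f j) (tnth f l) =
  \sum_(t : 'I_n * 'I_n * 'I_n)
     w (m (tnth e t.1.2) (tnth e t.2)) (tnth e t.1.1)
       *: T (tnth f t.1.1) (tnth f t.1.2) (tnth f t.2).
Proof.
rewrite -(pair_bigA _ (fun t c =>
  w (m (tnth e t.2) (tnth e c)) (tnth e t.1)
       *: T (tnth f t.1) (tnth f t.2) (tnth f c))) /=.
rewrite -(pair_bigA _ (fun a b => \sum_c
  w (m (tnth e b) (tnth e c)) (tnth e a)
       *: T (tnth f a) (tnth f b) (tnth f c))) /=.
rewrite [RHS]exchange_big; apply: eq_bigr => b _ /=.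
rewrite [RHS]exchange_big; apply: eq_bigr => c _ /=.
by case: Ttri => T1 _ _; rewrite {1}[m _ _]basis_expansion (lin_sumZ _ _ (T1 _ _)).
Qed.

(** Both dual pairs are swapped before the product is expanded, so the two signs cancel. *)
Lemma dual_bases_prod3 :
  \sum_j \sum_l T (tnth e j) (tnth e l) (m (tnth f j) (tnth f l)) =
  \sum_(t : 'I_n * 'I_n * 'I_n)
     w (m (tnth e t.1.1) (tnth e t.1.2)) (tnth e t.2)
       *: T (tnth f t.1.1) (tnth f t.1.2) (tnth f t.2).
Proof.
rewrite -(pair_bigA _ (fun t c =>
  w (m (tnth e t.1) (tnth e t.2)) (tnth e c)
       *: T (tnth f t.1) (tnth f t.2) (tnth f c))) /=.
rewrite -(pair_bigA _ (fun a b => \sum_c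
  w (m (tnth e a) (tnth e b)) (tnth e c)
       *: T (tnth f a) (tnth f b) (tnth f c))) /=.
under eq_bigr => j _.
  rewrite (dual_bases_skew (T := fun u v => T (tnth e j) u (m (tnth f j) v)));
    last by split=> ? ? ? ?; rewrite !P.
  over.
rewrite sumrN exchange_big -sumrN /= [RHS]exchange_big /=.
apply: eq_bigr => l _.
rewrite (dual_bases_skew (T := fun u v => T u (tnth f l) (m v (tnth e l))));
  last by split=> ? ? ? ?; rewrite !P.
rewrite opprK; apply: eq_bigr => j _.
by case: Ttri => _ _ T3; rewrite {1}[m _ _]basis_expansion (lin_sumZ _ _ (T3 _ _)).
Qed.

(** Only the pair indexed by l has to be swapped, which leaves one sign. *)
Lemma dual_bases_prod2 :
  \sum_j \sum_l T (tnth e l) (m (tnth e j) (tnth f l)) (tnth f j) =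
  - \sum_(t : 'I_n * 'I_n * 'I_n)
     w (m (tnth e t.2) (tnth e t.1.1)) (tnth e t.1.2)
       *: T (tnth f t.1.1) (tnth f t.1.2) (tnth f t.2).
Proof.
rewrite -(pair_bigA _ (fun t c =>
  w (m (tnth e c) (tnth e t.1)) (tnth e t.2)
       *: T (tnth f t.1) (tnth f t.2) (tnth f c))) /=.
rewrite -(pair_bigA _ (fun a b => \sum_c
  w (m (tnth e c) (tnth e a)) (tnth e b)
       *: T (tnth f a) (tnth f b) (tnth f c))) /=.
under eq_bigr => j _.
  rewrite (dual_bases_skew (T := fun u v => T u (m (tnth e j) v) (tnth f j)));
    last by split=> ? ? ? ?; rewrite !P.
  over.
rewrite sumrN exchange_big /=; congr (- _); apply: eq_bigr => l _.
rewrite [RHS]exchange_big; apply: eq_bigr => j _ /=.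
by case: Ttri => _ T2 _; rewrite {1}[m _ _]basis_expansion (lin_sumZ _ _ (T2 _ _)).
Qed.

End TripleProducts.
End DualBases.

(** * Symmetries of the trilinear form ϖ(a ⋄ b, c) *)

Section InvariantForm.
Variables (K : fieldType) (B : zinbielAlgType K) (w : {skew_symmetric B}).
Hypothesis winv : forall a b c : B, w (a ⋄ b) c = w b (a ⋄ c + c ⋄ a).

Lemma zinbiel_form_sum a b c : w (a ⋄ b) c = - (w (a ⋄ c) b + w (c ⋄ a) b).
Proof. by rewrite winv skewC linearDl. Qed.

(** The right-hand side of [zinbiel_form_sum] is symmetric in a and c. So the value depends only on
    which argument is in the middle, and the three values add up to zero. *)
Lemma zinbiel_form_sym a b c : w (a ⋄ b) c = w (c ⋄ b) a.
Proof. by rewrite zinbiel_form_sum [RHS]zinbiel_form_sum addrC. Qed.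

End InvariantForm.

(** * Consequences of the diassociative equation for symmetric r *)

Section SymmetricSolution.
Variables (K : fieldType) (D : diassAlgType K) (I : finType) (x y : I -> D).
Hypothesis rsym : tsymmetric (\sum_i x i ⊗ y i).
Hypothesis rsol : daybe (\sum_i x i ⊗ y i).

(** Obtained by applying the linear map induced by [T] to τ(r) = r. *)
Lemma tsymmetric_sum (W : vectType K) (T : D -> D -> W) : bilin T ->
  \sum_i T (x i) (y i) = \sum_i T (y i) (x i).
Proof.
move=> Tb; have := congr1 (tensor_ext T) rsym.
rewrite /tswap !linear_sum /=.
under eq_bigr => i _ do rewrite -/(tswap _) tswapE tensor_extE //.
by under [RHS]eq_bigr => i _ do rewrite tensor_extE //.
Qed.

Section Trilinear.
Variables (W : vectType K) (T : D -> D -> D -> W).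
Hypothesis Ttri : trilin T.

Lemma daybe_trilin :
  \sum_i \sum_k (T (x i) (x k) (y i ⊢ y k) - T (x k) (x i ⊣ y k) (y i)
    - T (x i ⊢ x k) (y i) (y k) + T (x i ⊣ x k) (y i) (y k)) = 0.
Proof.
pose L := tensor_ext (fun s w => tensor_ext (fun u v => T u v w) s).
have /(congr1 L) := (daybeE x y).1 rsol.
rewrite /L linear0 linear_sum => rT; rewrite -[RHS]rT; apply: eq_bigr => i _.
rewrite linear_sum; apply: eq_bigr => k _.
by rewrite linearD !linearB /= !(tensor_ext_tens3 Ttri).
Qed.

End Trilinear.

Section Cyclic.
Variables (W : vectType K) (T : D -> D -> D -> W).
Hypothesis Ttri : trilin T.

Let P := (trilinP1 Ttri, trilinP2 Ttri, trilinP3 Ttri,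
  bilinPl (@dashv_bilin _ D), bilinPr (@dashv_bilin _ D),
  bilinPl (@vdash_bilin _ D), bilinPr (@vdash_bilin _ D)).

(** This is [daybe_trilin] for T(c, a, b), up to exchanging x and y in one or both copies of r: both
    in the first term, copy i in the second, copy k in the last two. *)
Lemma daybe_cyclic :
  \sum_i \sum_k (T (x i ⊢ x k) (y i) (y k) - T (x i) (x k) (y i ⊣ y k)
    - T (x k) (x i ⊢ y k) (y i) + T (x k) (x i ⊣ y k) (y i)) = 0.
Proof.
have Ttri' : trilin (fun a b c => T c a b) by split=> ? ? ? ? ?; rewrite P.
have := daybe_trilin Ttri'; under eq_bigr do rewrite big_split !sumrB /=.
rewrite big_split !sumrB /= => rT.
under eq_bigr do rewrite big_split !sumrB /=.
rewrite big_split !sumrB /= -[RHS]rT; congr (_ - _ - _ + _).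
- rewrite (tsymmetric_sum (T := fun u v => \sum_k T (u ⊢ x k) v (y k))); last first.
    by split=> ? ? ? ?; rewrite scaler_sumr -big_split;
       apply: eq_bigr => k _; rewrite !P.
  apply: eq_bigr => i _.
  by apply: (tsymmetric_sum (T := fun u v => T (y i ⊢ u) (x i) v)); split=> ? ? ? ?; rewrite !P.
- apply: (tsymmetric_sum (T := fun u v => \sum_k T u (x k) (v ⊣ y k))).
  by split=> ? ? ? ?; rewrite scaler_sumr -big_split;
     apply: eq_bigr => k _; rewrite !P.
- apply: eq_bigr => i _.
  by apply: (tsymmetric_sum (T := fun u v => T u (x i ⊢ v) (y i))); split=> ? ? ? ?; rewrite !P.
- apply: eq_bigr => i _.
  by apply: (tsymmetric_sum (T := fun u v => T u (x i ⊣ v) (y i))); split=> ? ? ? ?; rewrite !P.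
Qed.

(** The sum is p + q times [daybe_cyclic] plus q times [daybe_trilin]. *)
Lemma daybe_pencil (p q : K) :
  \sum_i \sum_k (p *: T (x i ⊢ x k) (y i) (y k) + q *: T (x i ⊣ x k) (y i) (y k)
    + q *: T (x i) (x k) (y i ⊢ y k) - (p + q) *: T (x i) (x k) (y i ⊣ y k)
    - (p + q) *: T (x k) (x i ⊢ y k) (y i) + p *: T (x k) (x i ⊣ y k) (y i)) = 0.
Proof.
have := congr2 +%R (congr1 ( *:%R (p + q)) daybe_cyclic)
                   (congr1 ( *:%R q) (daybe_trilin Ttri)).
rewrite !scaler0 addr0 !scaler_sumr -big_split /= => rT; rewrite -[RHS]rT.
apply: eq_bigr => i _; rewrite !scaler_sumr -big_split /=.
apply: eq_bigr => k _.
rewrite !scalerDr !scalerN !scalerDl !addrA.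
(* The pairs (2*9) and (6*8) are the opposite q-multiples of T(x_i ⊢ x_k, y_i, y_k) and T(x_k, x_i ⊣
   y_k, y_i). *)
by rewrite [RHS](ACl (1*10*7*3*4*5*(2*9)*(6*8)))%AC /= !subrr !addr0.
Qed.

End Cyclic.
End SymmetricSolution.

(** * Tensors over D ⊗ B, with the two kinds of factors separated *)

Section InducedTensors.
Variables (K : fieldType) (D : diassAlgType K) (B : zinbielAlgType K).

(** Grouping the arguments by algebra lets identities in D apply with the B-part fixed, and
    conversely. *)
Definition tens_prod2 (d1 d2 : D) (b1 b2 : B) :
    tensor (induced D B) (induced D B) :=
  (d1 ⊗ b1 : induced D B) ⊗ (d2 ⊗ b2 : induced D B).

Definition tens_prod3 (d1 d2 d3 : D) (b1 b2 b3 : B) :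
    tensor (tensor (induced D B) (induced D B)) (induced D B) :=
  tens_prod2 d1 d2 b1 b2 ⊗ (d3 ⊗ b3 : induced D B).

Let tensP := (bilinPl (tens_bilin D B), bilinPr (tens_bilin D B),
  bilinPl (tens_bilin (induced D B) (induced D B)),
  bilinPr (tens_bilin (induced D B) (induced D B)),
  bilinPl (tens_bilin (tensor (induced D B) (induced D B)) (induced D B)),
  bilinPr (tens_bilin (tensor (induced D B) (induced D B)) (induced D B))).

Lemma tens_prod2_bilin_diass b1 b2 : bilin (fun d1 d2 => tens_prod2 d1 d2 b1 b2).
Proof. by split=> ? ? ? ?; rewrite /tens_prod2 !tensP. Qed.

Lemma tens_prod2_bilin_zinbiel d1 d2 : bilin (tens_prod2 d1 d2).
Proof. by split=> ? ? ? ?; rewrite /tens_prod2 !tensP. Qed.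

Lemma tens_prod3_trilin_diass b1 b2 b3 :
  trilin (fun d1 d2 d3 => tens_prod3 d1 d2 d3 b1 b2 b3).
Proof. by split=> ? ? ? ? ?; rewrite /tens_prod3 /tens_prod2 !tensP. Qed.

Lemma tens_prod3_trilin_zinbiel d1 d2 d3 : trilin (tens_prod3 d1 d2 d3).
Proof. by split=> ? ? ? ? ?; rewrite /tens_prod3 /tens_prod2 !tensP. Qed.

Lemma aybe_term_induced (d d' c c' : D) (a a' b b' : B) :
  aybe_term (d ⊗ a : induced D B) (d' ⊗ a' : induced D B)
            (c ⊗ b : induced D B) (c' ⊗ b' : induced D B) =
  tens_prod3 (d ⊢ c) d' c' (a ⋄ b) a' b'
  + tens_prod3 (d ⊣ c) d' c' (b ⋄ a) a' b'
  + tens_prod3 d c (d' ⊢ c') a b (a' ⋄ b')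
  + tens_prod3 d c (d' ⊣ c') a b (b' ⋄ a')
  - tens_prod3 c (d ⊢ c') d' b (a ⋄ b') a'
  - tens_prod3 c (d ⊣ c') d' b (b' ⋄ a) a'.
Proof.
rewrite /aybe_term !inducedE /tens_prod3 /tens_prod2.
by rewrite !(bilinDl (@tens_bilin _ _ _)) !(bilinDr (@tens_bilin _ _ _))
  !(bilinDl (@tens_bilin _ _ _)) opprD !addrA.
Qed.

End InducedTensors.

(** * Summing the associative Yang-Baxter terms over the dual bases *)

Section AybeExpansion.
Variables (K : fieldType) (D : diassAlgType K) (B : zinbielAlgType K).
Variables (w : {skew_symmetric B}) (n : nat) (e f : n.-tuple B).
Hypothesis winv : forall a b c : B, w (a ⋄ b) c = w b (a ⋄ c + c ⋄ a).
Hypothesis ebasis : basis_of {:B} e.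
Hypothesis fdual : forall i j, w (tnth f i) (tnth e j) = (i == j)%:R.

(** For [t] = (a, b, c), [p] is the form's value with e_c in the middle and [q] the one with e_b;
    having e_a in the middle gives -(p + q). *)
Lemma aybe_term_dual_bases (d d' c c' : D) :
  \sum_j \sum_l
     aybe_term (d ⊗ tnth e j : induced D B) (d' ⊗ tnth f j : induced D B)
               (c ⊗ tnth e l : induced D B) (c' ⊗ tnth f l : induced D B) =
  \sum_(t : 'I_n * 'I_n * 'I_n)
    (let T d1 d2 d3 :=
       tens_prod3 d1 d2 d3 (tnth f t.1.1) (tnth f t.1.2) (tnth f t.2) in
     let p := w (tnth e t.1.2 ⋄ tnth e t.2) (tnth e t.1.1) in
     let q := w (tnth e t.2 ⋄ tnth e t.1.2) (tnth e t.1.1) in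
     p *: T (d ⊢ c) d' c' + q *: T (d ⊣ c) d' c'
     + q *: T d c (d' ⊢ c') - (p + q) *: T d c (d' ⊣ c')
     - (p + q) *: T c (d ⊢ c') d' + p *: T c (d ⊣ c') d').
Proof.
have zb : bilin (fun u v : B => u ⋄ v) := @zmul_bilin K B.
(* The ⊣ terms carry the opposite product of B. *)
have zb' : bilin (fun u v : B => v ⋄ u) by split=> [v|u]; [apply: zb.2 | apply: zb.1].
have Tz (d1 d2 d3 : D) := tens_prod3_trilin_zinbiel B d1 d2 d3.
under eq_bigr => j _.
  under eq_bigr => l _ do rewrite aybe_term_induced.
  rewrite !sumrB !big_split /=; over.
rewrite !sumrB !big_split /=.
rewrite (dual_bases_prod1 ebasis fdual (@zmul K B) (Tz _ _ _)).
rewrite (dual_bases_prod1 ebasis fdual (fun u v => v ⋄ u) (Tz _ _ _)).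
rewrite (dual_bases_prod3 ebasis fdual (Tz _ _ _) zb).
rewrite (dual_bases_prod3 ebasis fdual (Tz _ _ _) zb').
rewrite (dual_bases_prod2 ebasis fdual (Tz _ _ _) zb).
rewrite (dual_bases_prod2 ebasis fdual (Tz _ _ _) zb').
rewrite !opprK -!big_split /=; apply: eq_bigr => t _.
rewrite (zinbiel_form_sym winv (tnth e t.1.1) (tnth e t.1.2)).
rewrite (zinbiel_form_sym winv (tnth e t.1.1) (tnth e t.2)).
rewrite (zinbiel_form_sum winv (tnth e t.1.2) (tnth e t.1.1)).
rewrite (zinbiel_form_sum winv (tnth e t.2) (tnth e t.1.1)).
by rewrite [X in - X *: tens_prod3 c _ _ _ _ _]addrC !scaleNr.
Qed.

End AybeExpansion.

(** * Skew-symmetry of r~ and its associative Yang-Baxter equation *)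

Theorem proposition3p9 (K : fieldType) (charK0 : [pchar K] =i pred0)
    (D : diassAlgType K) (B : zinbielAlgType K) (w : {skew_symmetric B})
    (Bquad : quadratic_zinbiel w)
    (I : finType) (x y : I -> D)
    (rsym : tsymmetric (\sum_i x i ⊗ y i))
    (rsol : daybe (\sum_i x i ⊗ y i))
    (n : nat) (e f : n.-tuple B) (ebasis : basis_of {:B} e)
    (fdual : forall i j : 'I_n, w (tnth f i) (tnth e j) = (i == j)%:R) :
  let rt : tensor (induced D B) (induced D B) :=
    \sum_i \sum_j
      (x i ⊗ tnth e j : induced D B) ⊗ (y i ⊗ tnth f j : induced D B) in
  tskew rt /\ aybe rt.
Proof.
move=> rt; have [_ winv] := Bquad; split.
  rewrite /tskew {1}/rt /tswap linear_sum.
  under eq_bigr => i _.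
    rewrite linear_sum.
    under eq_bigr => j _ do rewrite /= -/(tswap _) tswapE -/(tens_prod2 _ _ _ _).
    over.
  (* The swap exchanges x with y and e with f: symmetry of r undoes the former, and the latter costs
     a sign. *)
  rewrite -(tsymmetric_sum rsym (T := fun d d' =>
      \sum_j tens_prod2 d d' (tnth f j) (tnth e j))); last first.
    split=> d a d1 d2; rewrite scaler_sumr -big_split; apply: eq_bigr => j _ /=;
      by rewrite !(bilinPl (tens_prod2_bilin_diass _ _ _),
                   bilinPr (tens_prod2_bilin_diass _ _ _)).
  rewrite /rt -sumrN; apply: eq_bigr => i _.
  rewrite (dual_bases_skew ebasis fdual (tens_prod2_bilin_zinbiel B (x i) (y i))).
  by rewrite opprK.
rewrite /rt pair_bigA; apply/aybeE.
rewrite -(pair_bigA _ (fun i j => \sum_(q : I * 'I_n)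
  aybe_term (x i ⊗ tnth e j : induced D B) (y i ⊗ tnth f j : induced D B)
    (x q.1 ⊗ tnth e q.2 : induced D B) (y q.1 ⊗ tnth f q.2 : induced D B))) /=.
(* The sums over the dual bases move inside, so that they are evaluated with the elements of D
   fixed. *)
transitivity (\sum_i \sum_k \sum_j \sum_l
  aybe_term (x i ⊗ tnth e j : induced D B) (y i ⊗ tnth f j : induced D B)
    (x k ⊗ tnth e l : induced D B) (y k ⊗ tnth f l : induced D B)).
  apply: eq_bigr => i _; rewrite [RHS]exchange_big; apply: eq_bigr => j _ /=.
  by rewrite pair_bigA.
under eq_bigr => i _.
  under eq_bigr => k _ do rewrite (aybe_term_dual_bases winv ebasis fdual).
  rewrite exchange_big; over.
(* With the triple [t] outermost, p and q are constants and each summand vanishes separately. *)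
rewrite exchange_big big1 // => t _.
exact: (daybe_pencil rsym rsol (tens_prod3_trilin_diass _ _ _ _)).
Qed.
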